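(* Let $n \geq 1$ and let $q \in \mathbb{C}$ be a primitive $n$th root of unity. (i) If $n$ is odd, then $$\sum_{k=0}^{n-1} (q^2;q^2)_kq^{k+1} = \frac{-1}{n^2} \sum_{k=-n}^{n-1} \sum_{j=-k}^k \mathrm{sgn}(k) \left(k^2-\frac{j(3j+1)}{2}\right)(-1)^{k+j}q^{k^2-j(3j+1)/2},$$ and if $n$ is even, then $$\sum_{k=0}^{n-1} (q^2;q^2)_kq^{k+1} = \frac{-1}{4} \sum_{k=-n}^{n-1} \sum_{j=-k}^k \mathrm{sgn}(k)(-1)^{k+j}q^{k^2-j(3j+1)/2}.$$ (ii) If $n$ is even, then $$\sum_{k=0}^{n-1} (-q)_k = \frac{1}{4} \sum_{k=-n}^{n-1} \sum_{j=-k}^k \mathrm{sgn}(k)(-1)^{k+j}q^{-k^2+j(3j+1)/2}.$$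
   Context: For a non-negative integer $k$, $(a;q)_k = \prod_{i=0}^{k-1}(1-aq^i)$, and $(a)_k$ denotes $(a;q)_k$; thus $(q^2;q^2)_k=\prod_{i=1}^k(1-q^{2i})$ and $(-q)_k=\prod_{i=1}^k(1+q^i)$. The sign function is $\mathrm{sgn}(k)=1$ if $k \geq 0$ and $\mathrm{sgn}(k)=-1$ if $k<0$. Sums with reversed limits follow the convention that for any $f$, $\sum_{j=a}^b f(j) = - \sum_{j=b+1}^{a-1} f(j)$ whenever $a > b$; in particular, for $k<0$, $\sum_{j=-k}^{k} f(j) = -\sum_{j=k+1}^{-k-1} f(j)$. *)

(* Defs.v *)
From mathcomp Require Import all_boot all_order all_algebra zify.
From mathcomp Require Export complex.
From mathcomp Require Export reals.

Set Implicit Arguments.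
Unset Strict Implicit.
Unset Printing Implicit Defensive.

Import Order.TTheory GRing.Theory Num.Theory.
Local Open Scope ring_scope.

Definition qpoch (C : pzRingType) (a q : C) (k : nat) : C :=
  \prod_(i < k) (1 - a * q ^+ i).

(* Unlike sgz, this takes the value 1 at 0. *)
Definition sgnz (k : int) : int := if 0 <= k then 1 else -1.

(* The sum over a <= j <= b, with the convention that for b < a it is minus
   the sum over b + 1 <= j <= a - 1 (hence 0 when a = b + 1). *)
Definition sumz (V : zmodType) (a b : int) (f : int -> V) : V :=
  if a <= b then \sum_(i < `|(b - a + 1)%R|%N) f (a + i%:Z)
  else - \sum_(i < `|(a - 1 - b)%R|%N) f (b + 1 + i%:Z).

(* The division is exact, see double_pentz. *)
Definition pentz (j : int) : int := ((j * (3 * j + 1)) %/ 2)%Z.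

Lemma sumz_rev (V : zmodType) (a b : int) (f : int -> V) :
  b < a -> sumz a b f = - sumz (b + 1) (a - 1) f.
Proof.
move=> ltba; rewrite /sumz leNgt ltba /=; case: ifP => [_ | ge].
  by congr (- _); have -> : (a - 1 - (b + 1) + 1 = a - 1 - b)%R by lia.
have -> : a = b + 1 by lia.
have -> : `|(b + 1 - 1 - b)%R|%N = 0%N by lia.
have -> : `|(b + 1 - 1 - (b + 1 - 1))%R|%N = 0%N by lia.
by rewrite !big_ord0 !oppr0.
Qed.

Lemma double_pentz (j : int) : 2 * pentz j = j * (3 * j + 1).
Proof.
rewrite /pentz mulrC divzK //.
have [m [-> | ->]] : exists m : int, j = 2 * m \/ j = 2 * m + 1.
- by exists (j %/ 2)%Z; lia.
- by rewrite -mulrA dvdz_mulr.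
- by apply/dvdzP; exists ((2 * m + 1) * (3 * m + 2)); nia.
Qed.

(* Main.v *)
Require Import Defs.
From mathcomp Require Import all_boot all_order all_algebra.
From mathcomp Require Import ring zify.
Set Implicit Arguments.
Unset Strict Implicit.
Unset Printing Implicit Defensive.
Import Order.TTheory GRing.Theory Num.Theory.
Local Open Scope ring_scope.

(** Write (a)_k for qpoch a q k, S_r for the sum of (-1)^j q^(-j(3j+1)/2) over
    |j| <= r, and t_r = (-1)^r q^(r^2) S_r (1 - q^(2r+1)).  Grouping k = r with
    k = -(r+1) turns the double sum of the theorem into the sum of the t_r for
    0 <= r < n, and its weighted form into the same sum with every power q^e
    replaced by e q^e, that is, into its image under q d/dq.

    The identity behind both evaluations of the sum of (q^2;q^2)_k q^k holds for
    generic q.  With N = n - 1,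

      sum_(k <= N) (-q)_k (q^-N)_k q^k
        = (-q)_N (-q)^N / (q)_n
          * sum_(r <= N) t_r prod_(1 <= i <= r) (q^n - q^i) / (1 - q^(n+i)).

    It is the finite Bailey lemma for the pair whose beta is constantly 1 and
    whose alpha is q^(2r^2+r) (1 - q^(2r+1)) S_r / (1 - q)
    ([bailey_pair_beta1]); the conjugate sum is a q-Chu-Vandermonde sum.  At a primitive n-th root of
    unity z, (z^-N)_k = (z)_k and (-z)_k (z)_k = (z^2;z^2)_k, so the left side
    becomes the wanted sum, and every product over i becomes 1.  But (q)_n
    vanishes at z, so one clears denominators, obtains a polynomial identity in
    q ([finite_bailey_identity_poly]) and removes the zero at z.

    For even n, (-q)_N has the factor 1 + q^(n/2), which also vanishes at z and
    divides 1 - q^n.  Cancelling it and evaluating gives the factor -1/4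
    ([sum_at_even_root]).

    For odd n, (-z)_N = 1, so the zero of 1 - q^n must come from the sum on the
    right: the reflection r -> N - r sends t_r to -t_r at z, so that sum is 0.
    Differentiating at z then yields the weighted sum.  The derivatives of the
    products over i contribute nothing: to first order they are multiples of
    the sums of (1+z^i)/(1-z^i) over 1 <= i <= r, which are even under the
    reflection, so that their products with the odd t_r add up to 0
    ([sum_at_odd_root]).

    The last formula reduces to the even case at z^-1.  The sum of the (-z)_k
    terminates because (-z)_k = (z^-M)_k with M = n/2 - 1, and reversing such a
    terminating sum ([sum_qpoch_reversal]) produces minus the sum of
    (w^2;w^2)_k w^(k+1) with w = z^-1. *)

(** * q-shifted factorials *)

Section QPoch.
Variable A : comNzRingType.
Implicit Types a q : A.

Lemma qpoch0 a q : qpoch a q 0 = 1.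
Proof. by rewrite /qpoch big_ord0. Qed.

Lemma qpochS a q k : qpoch a q k.+1 = qpoch a q k * (1 - a * q ^+ k).
Proof. by rewrite /qpoch big_ord_recr. Qed.

Lemma qpochD a q m k :
  qpoch a q (m + k) = qpoch a q m * qpoch (a * q ^+ m) q k.
Proof.
elim: k => [|k IH]; first by rewrite addn0 qpoch0 mulr1.
by rewrite addnS !qpochS IH -!mulrA -exprD.
Qed.

Lemma qpochSl a q k : qpoch a q k.+1 = (1 - a) * qpoch (a * q) q k.
Proof. by rewrite -add1n qpochD qpochS qpoch0 mul1r mulr1 expr1. Qed.

Lemma qpoch_sqr q k :
  qpoch (q ^+ 2) (q ^+ 2) k = qpoch q q k * qpoch (- q) q k.
Proof.
elim: k => [|k IH]; first by rewrite !qpoch0 mulr1.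
rewrite !qpochS IH -exprM mulnC exprM; set x := q ^+ k; ring.
Qed.

End QPoch.

(** * The q-Chu-Vandermonde sum *)

Section ChuVandermonde.
Variables (F : fieldType) (q : F).
Hypothesis q0 : q != 0.
Hypothesis q1 : forall i, (0 < i)%N -> 1 - q ^+ i != 0.

Lemma qpoch_qq_neq0 k : qpoch q q k != 0.
Proof. by apply/prodf_neq0 => i _; rewrite -exprS q1. Qed.

(** The Pascal rule for q-binomial coefficients: (q^-M)_s / (q)_s is, up to a
    sign and a power of q, the coefficient [M choose s]. *)
Lemma q_chu_coef_pascal M s :
  qpoch (q ^- M.+1) q s.+1 * q ^+ s.+1 / qpoch q q s.+1 =
  qpoch (q ^- M) q s.+1 * q ^+ s.+1 / qpoch q q s.+1
  - q ^- M * (qpoch (q ^- M) q s * q ^+ s / qpoch q q s).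
Proof.
rewrite qpochSl !(qpochS q q) (qpochS (q ^- M)).
have -> : q ^- M.+1 * q = q ^- M by rewrite exprSr; field; rewrite q0 expf_neq0.
have h1 := qpoch_qq_neq0 s; have h2 := q1 (ltn0Sn s).
rewrite -exprS in h2 *.
rewrite !exprS in h2 *.
by field; rewrite h2 h1 q0 expf_neq0.
Qed.

Definition q_chu_sum a c M := \sum_(s < M.+1)
  qpoch a q s * qpoch (q ^- M) q s * q ^+ s / (qpoch q q s * qpoch c q s).

Lemma qpoch_qVn M : qpoch (q ^- M) q M.+1 = 0.
Proof. by rewrite qpochS mulVf ?expf_neq0 // subrr mulr0. Qed.

(** Pascal's rule gives f_{M+1}(a, c) = f_M(a, c) - q^-M (1-a)/(1-c) f_M(aq, cq)
    for the sum f_M, and the product on the right obeys the same recurrence. *)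
Lemma q_chu_vandermonde a c M : a != 0 -> (forall i, 1 - c * q ^+ i != 0) ->
  q_chu_sum a c M = a ^+ M * qpoch (c / a) q M / qpoch c q M.
Proof.
elim: M a c => [|M IH] a c a0 cP.
  by rewrite /q_chu_sum big_ord_recl big_ord0 /= !qpoch0 !expr0 !(mulr1, invr1, addr0).
have cP' k : qpoch c q k != 0 by apply/prodf_neq0.
have c1 : 1 - c != 0 by have := cP 0%N; rewrite expr0 mulr1.
have cPq i : 1 - c * q * q ^+ i != 0 by rewrite -mulrA -exprS.
have -> : q_chu_sum a c M.+1 =
    q_chu_sum a c M - q ^- M * ((1 - a) / (1 - c)) * q_chu_sum (a * q) (c * q) M.
  rewrite {1}/q_chu_sum big_ord_recl /=.
  have -> : q_chu_sum a c M = 1 + \sum_(s < M.+1)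
      qpoch a q s.+1 * qpoch (q ^- M) q s.+1 * q ^+ s.+1 /
      (qpoch q q s.+1 * qpoch c q s.+1).
    rewrite big_ord_recr /= qpoch_qVn mulr0 !mul0r addr0.
    by rewrite /q_chu_sum big_ord_recl /= !qpoch0 !expr0 !(mulr1, invr1).
  rewrite -addrA; congr (_ + _); first by rewrite !qpoch0 !expr0 !(mulr1, invr1).
  rewrite /q_chu_sum mulr_sumr -sumrB; apply: eq_bigr => s _.
  rewrite /bump /= add1n.
  have := q_chu_coef_pascal M s; set x := _ / qpoch q q s.+1 => hx.
  transitivity (x * (qpoch a q s.+1 / qpoch c q s.+1)).
    by rewrite /x; field; rewrite ?qpoch_qq_neq0 ?cP'.
  rewrite hx !(qpochSl a) !(qpochSl c).
  have := cP' s.+1; rewrite qpochSl mulf_eq0 negb_or => /andP[_ h].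
  by field; rewrite c1 h ?qpoch_qq_neq0 ?q0 ?expf_neq0.
rewrite !IH ?mulf_neq0 //.
have -> : c * q / (a * q) = c / a by field; rewrite a0 q0.
have := cP' M.+1; rewrite qpochSl mulf_eq0 negb_or => /andP[_ h].
have e : (1 - c) * qpoch (c * q) q M = qpoch c q M * (1 - c * q ^+ M).
  by rewrite -qpochSl qpochS.
have e' : qpoch (c * q) q M = qpoch c q M * (1 - c * q ^+ M) / (1 - c).
  by rewrite -e; field.
rewrite e' !qpochS exprMn exprS.
by field; rewrite a0 c1 cP cP' ?q0 ?expf_neq0.
Qed.
End ChuVandermonde.

(** * Symmetric sums and partial sums of the pentagonal series *)

Definition symsum (V : zmodType) (r : nat) (f : int -> V) : V :=
  f 0 + \sum_(j < r) (f j.+1%:Z + f (- j.+1%:Z)).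

Lemma symsumS (V : zmodType) (r : nat) (f : int -> V) :
  symsum r.+1 f = symsum r f + (f r.+1%:Z + f (- r.+1%:Z)).
Proof. by rewrite /symsum big_ord_recr /= addrA. Qed.

Lemma eq_symsum (V : zmodType) r (f g : int -> V) :
  (forall j, (`|j| <= r)%N -> f j = g j) -> symsum r f = symsum r g.
Proof.
move=> fg; rewrite /symsum fg //; congr (_ + _); apply: eq_bigr => j _.
by rewrite !fg // ?abszN absz_nat.
Qed.

Lemma raddf_symsum (U V : zmodType) (h : {additive U -> V}) r (f : int -> U) :
  h (symsum r f) = symsum r (h \o f).
Proof.
by rewrite /symsum raddfD raddf_sum; congr (_ + _); apply: eq_bigr => j _; rewrite raddfD.
Qed.

Lemma symsumD (V : zmodType) r (f g : int -> V) :
  symsum r f + symsum r g = symsum r (fun j => f j + g j).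
Proof.
rewrite /symsum addrACA -big_split; congr (_ + _); apply: eq_bigr => j _.
exact: addrACA.
Qed.

Lemma mulr_symsumr (A : pzRingType) r (x : A) (f : int -> A) :
  x * symsum r f = symsum r (fun j => x * f j).
Proof.
rewrite /symsum mulrDr mulr_sumr; congr (_ + _).
by apply: eq_bigr => j _; rewrite mulrDr.
Qed.

Lemma double_bin2 (r : nat) : (2 * 'C(r, 2) + r = r * r)%N.
Proof. by elim: r => // r; rewrite binS bin1; lia. Qed.

Lemma pentz_pos (r : nat) : pentz r%:Z = (2 * r ^ 2)%N%:Z - 'C(r, 2)%:Z.
Proof. by have := double_pentz r; have := double_bin2 r; nia. Qed.

Lemma pentz_neg (r : nat) : pentz (- r%:Z) = (2 * r ^ 2)%N%:Z - ('C(r, 2) + r)%N%:Z.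
Proof. by have := double_pentz (- r%:Z); have := double_bin2 r; nia. Qed.

Lemma big_triangle (V : nmodType) (G : nat -> nat -> V) n :
  \sum_(k < n) \sum_(r < k.+1) G k r = \sum_(r < n) \sum_(s < n - r) G (r + s)%N r.
Proof.
elim: n => [|n IH]; first by rewrite !big_ord0.
rewrite !big_ord_recr /= IH subSn // subnn big_ord1 addn0 addrA -big_split /=.
congr (_ + _); apply: eq_bigr => r _.
by rewrite subSn 1?ltnW // big_ord_recr /= subnKC 1?ltnW.
Qed.

Section Bailey.
Variables (F : fieldType) (q : F).
Hypothesis q0 : q != 0.

Definition pentsum r : F := symsum r (fun j => (-1) ^+ `|j|%N * q ^ (- pentz j)).

Lemma pentsum0 : pentsum 0 = 1.
Proof. by rewrite /pentsum /symsum big_ord0 addr0 expr0 mul1r. Qed.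

Lemma pentsumS r : pentsum r.+1 = pentsum r +
  (-1) ^+ r.+1 * q ^+ 'C(r.+1, 2) * (1 + q ^+ r.+1) / q ^+ (2 * r.+1 ^ 2).
Proof.
rewrite /pentsum symsumS; congr (_ + _).
rewrite pentz_pos pentz_neg !opprB !expfzDr // !exprnN abszN absz_nat.
rewrite -!exprnP exprD. have z0 : q ^+ (2 * r.+1 ^ 2) != 0 by rewrite expf_neq0.
by field.
Qed.

Hypothesis q1 : forall i, (0 < i)%N -> 1 - q ^+ i != 0.

(** * The Bailey pair with beta = 1 *)

(** For m = k and d = 0 this says that the sum vanishes; up to the factor q^k it
    is the increment from k - 1 to k of the sum in [bailey_pair_beta1].  The closed
    form of its partial sums comes from summation by parts.  The coefficient of
    S_r is H_r - H_{r+1} with H_r = q^(2r^2) / ((q)_{k-r} (q)_{k+r}), and then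
    (S_r - S_{r-1}) H_r = w_r (1 + q^r) with
    w_r = (-1)^r q^(r(r-1)/2) / ((q)_{k-r} (q)_{k+r}) telescopes again, being
    (K_r - K_{r+1}) / (1 - q^k) with K_r = w_r (1 - q^(k+r)).  The two terms on
    the right are -K_{m+1} / (1 - q^k) and -S_m H_{m+1}. *)
Lemma bailey_increment_partial k m d : (m + d)%N = k -> (0 < k)%N ->
  \sum_(r < m.+1) pentsum r * (q ^+ (2 * r ^ 2) * (1 - q ^+ (2 * r).+1) *
      (1 + q ^+ (2 * r).+1 - q ^+ (k + r).+1)
      / (qpoch q q (k - r) * qpoch q q (k + r).+1)) =
  (1 - q ^+ d) / (qpoch q q d * qpoch q q (k + m)) *
    ((-1) ^+ m * q ^+ ('C(m, 2) + m) / (1 - q ^+ k)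
     - pentsum m * q ^+ (2 * m.+1 ^ 2) / (1 - q ^+ (k + m).+1)).
Proof.
have P := qpoch_qq_neq0 q1.
elim: m d => [|m IH] d.
  rewrite add0n => -> k0.
  have h1 := q1 k0; have := q1 (ltn0Sn k); rewrite exprS => h2.
  rewrite big_ord1 subn0 !addn0 pentsum0 qpochS.
  rewrite -[(2 * 1 ^ 2)%N]/2%N -[(2 * 0 ^ 2)%N]/0%N -[(2 * 0).+1]/1%N -['C(0, 2)]/0%N !exprS !expr0.
  by field; rewrite P h1 h2.
move=> ek k0.
have P1 := P d; have P2 := P (k + m)%N.
have h1 := q1 k0; have h2 := q1 (ltn0Sn d).
have h3 := q1 (ltn0Sn (k + m)); have h4 := q1 (ltn0Sn (k + m).+1).
rewrite big_ord_recr /= (IH d.+1) //; last by rewrite -ek; lia.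
have -> : (k - m.+1 = d)%N by lia.
rewrite pentsumS !addnS !qpochS binS bin1 -!exprS.
have -> : q ^+ (2 * m.+2 ^ 2) = q ^+ (2 * m.+1 ^ 2) * (q ^+ m) ^+ 4 * q ^+ 6.
  by rewrite -exprM -!exprD; congr (_ ^+ _); nia.
have z0 : q ^+ (2 * m.+1 ^ 2) != 0 by rewrite expf_neq0.
move: (q ^+ (2 * m.+1 ^ 2)) z0 => z z0.
have -> : ((2 * m.+1).+1 = m + m + 3)%N by lia.
have ekm : (k + m = m + m + d + 1)%N by lia.
have ek' : (k = m + d + 1)%N by lia.
move: h1 h2 h3 h4 P1 P2; rewrite ekm -!addnS ek' !exprD !expr1 !exprS ?expr0.
move: (qpoch q q _) (qpoch q q _) => A B; move: (q ^+ m) (q ^+ d) => x y.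
move=> h1 h2 h3 h4 A0 B0.
have sub (a b : F) : a = b -> a != 0 -> b != 0 by move=> ->.
field; rewrite z0 A0 B0 /=; apply/and4P; split.
- by apply: sub h4; ring.
- by apply: sub h1; ring.
- by apply: sub h3; ring.
- by apply: sub h2; ring.
Qed.

(** This is the defining relation of a Bailey pair relative to a = q, with
    beta_k = 1, multiplied by 1 - q on alpha and on the denominators (q^2)_{k+r}. *)
Lemma bailey_pair_beta1 k : \sum_(r < k.+1)
  q ^+ (2 * r ^ 2 + r) * pentsum r * (1 - q ^+ (2 * r).+1)
    / (qpoch q q (k - r) * qpoch q q (k + r).+1) = 1.
Proof.
have P := qpoch_qq_neq0 q1.
elim: k => [|k IH].
  rewrite big_ord1 pentsum0 !expr0 !qpochS qpoch0.
  by field; have := q1 (ltn0Sn 0).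
have := @bailey_increment_partial k.+1 k.+1 0 (addn0 _) (ltn0Sn _).
rewrite expr0 subrr !mul0r => /(congr1 ( *%R (q ^+ k.+1))); rewrite mulr0 => h.
rewrite -[RHS]IH -[RHS]addr0 -[X in _ = _ + X]h.
rewrite [X in _ = _ + _ * X]big_ord_recr mulrDr addrA mulr_sumr -big_split.
rewrite big_ord_recr /=.
congr (_ + _).
  apply: eq_bigr => r _.
  have : (r <= k)%N by rewrite -ltnS.
  move: (nat_of_ord r) => {}r rk.
  have [d {rk IH h}->] : exists d, k = (d + r)%N by exists (k - r)%N; rewrite subnK.
  rewrite -addSn !addnK addSn.
  have := P d; have := P (d + r + r)%N.
  have := q1 (ltn0Sn d); have := q1 (ltn0Sn (d + r + r)).
  have := q1 (ltn0Sn (d + r + r).+1).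
  have -> : ((2 * r).+1 = r + r + 1)%N by lia.
  rewrite !addSn !qpochS -!exprS -!addnS !exprD !exprS ?expr0.
  move: (q ^+ d) (q ^+ r) (q ^+ (2 * r ^ 2)) (qpoch _ _ _) (qpoch _ _ _) => x y z A B.
  by move=> h1 h2 h3 h4 h5; field; rewrite h1 h2 h3 h4 h5.
have -> : ((2 * k.+1).+1 = (k.+1 + k.+1).+1)%N by lia.
by rewrite addrK exprD; ring.
Qed.

(** * The finite identity for generic q *)

(** After the shift k = r + s this is the q-Chu-Vandermonde sum with
    a = -q^(r+1), c = q^(2r+2) and M = N - r, for which c / a = a. *)
Lemma conjugate_bailey_sum N r : (r <= N)%N ->
  \sum_(s < (N - r).+1) qpoch (- q) q (r + s) * qpoch (q ^- N) q (r + s) * q ^+ (r + s)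
    / (qpoch q q s * qpoch q q (r + s + r).+1) =
  qpoch (- q) q N * qpoch (q ^- N) q r * q ^+ r * (- q ^+ r.+1) ^+ (N - r)
    / qpoch q q (N + r).+1.
Proof.
move=> rN; have P := qpoch_qq_neq0 q1.
have [M eN] : exists M, N = (r + M)%N by exists (N - r)%N; rewrite subnKC.
rewrite {}eN {rN N} addKn.
have a0 : - q ^+ r.+1 != 0 by rewrite oppr_eq0 expf_neq0.
have cP i : 1 - q ^+ (2 * r).+2 * q ^+ i != 0 by rewrite -exprD q1.
have := q_chu_vandermonde q0 q1 M a0 cP.
have -> : q ^+ (2 * r).+2 / - q ^+ r.+1 = - q ^+ r.+1.
  have -> : ((2 * r).+2 = r.+1 + r.+1)%N by lia.
  by rewrite exprD; field; rewrite ?q0 ?expf_neq0.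
move=> /(congr1 ( *%R (qpoch (- q) q r * qpoch (q ^- (r + M)) q r * q ^+ r
   / qpoch q q (2 * r).+1))).
have e x : qpoch q q ((2 * r).+1 + x) = qpoch q q (2 * r).+1 * qpoch (q ^+ (2 * r).+2) q x.
  by rewrite qpochD -exprS.
have e' x : qpoch (- q) q (r + x) = qpoch (- q) q r * qpoch (- q ^+ r.+1) q x.
  by rewrite qpochD mulNr -exprS.
have e'' x : qpoch (q ^- (r + M)) q (r + x) = qpoch (q ^- (r + M)) q r * qpoch (q ^- M) q x.
  rewrite qpochD; congr (_ * qpoch _ _ _).
  by rewrite exprD; field; rewrite ?q0 ?expf_neq0.
have -> : ((r + M + r).+1 = (2 * r).+1 + M)%N by lia.
have Q x : qpoch (q ^+ (2 * r).+2) q x != 0 by apply/prodf_neq0.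
rewrite e e' /q_chu_sum mulr_sumr => h.
transitivity (qpoch (- q) q r * qpoch (q ^- (r + M)) q r * q ^+ r /
     qpoch q q (2 * r).+1 *
     ((- q ^+ r.+1) ^+ M * qpoch (- q ^+ r.+1) q M /
      qpoch (q ^+ (2 * r).+2) q M)); last first.
  by field; rewrite Q P.
rewrite -{}h; apply: eq_bigr => s _.
have -> : ((r + s + r).+1 = (2 * r).+1 + s)%N by lia.
by rewrite e e' e'' [q ^+ (r + s)]exprD; field; rewrite Q !P.
Qed.

Definition row_value r : F :=
  (-1) ^+ r * q ^+ (r ^ 2) * pentsum r * (1 - q ^+ (2 * r).+1).

(** Bailey's lemma: insert [bailey_pair_beta1] as the factor 1, exchange the two
    summations, and evaluate the inner sum.  The factors are arranged so that
    each quotient in the product tends to 1 when q tends to a primitive root of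
    unity of order N + 1. *)
Lemma finite_bailey_identity N :
  \sum_(k < N.+1) qpoch (- q) q k * qpoch (q ^- N) q k * q ^+ k =
  qpoch (- q) q N * (- q) ^+ N / qpoch q q N.+1 *
  \sum_(r < N.+1) row_value r *
    \prod_(i < r) ((q ^+ N.+1 - q ^+ i.+1) / (1 - q ^+ (N.+1 + i.+1))).
Proof.
have P := qpoch_qq_neq0 q1.
pose al r := q ^+ (2 * r ^ 2 + r) * pentsum r * (1 - q ^+ (2 * r).+1).
transitivity (\sum_(k < N.+1) \sum_(r < k.+1)
    qpoch (- q) q k * qpoch (q ^- N) q k * q ^+ k
    * (al r / (qpoch q q (k - r) * qpoch q q (k + r).+1))).
  by apply: eq_bigr => k _; rewrite -mulr_sumr bailey_pair_beta1 mulr1.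
rewrite (big_triangle (fun k r => qpoch (- q) q k * qpoch (q ^- N) q k * q ^+ k
    * (al r / (qpoch q q (k - r) * qpoch q q (k + r).+1)))).
rewrite mulr_sumr; apply: eq_bigr => r _.
have rN : (r <= N)%N by rewrite -ltnS.
rewrite subSn //; move: (nat_of_ord r) rN => {}r rN.
transitivity (al r * \sum_(s < (N - r).+1)
    qpoch (- q) q (r + s) * qpoch (q ^- N) q (r + s) * q ^+ (r + s)
    / (qpoch q q s * qpoch q q (r + s + r).+1)).
  by rewrite mulr_sumr; apply: eq_bigr => s _; rewrite addKn; ring.
rewrite conjugate_bailey_sum //.
have -> : \prod_(i < r) ((q ^+ N.+1 - q ^+ i.+1) / (1 - q ^+ (N.+1 + i.+1))) =
  qpoch (q ^- N) q r * q ^+ (N.+1 * r) * qpoch q q N.+1 / qpoch q q (N + r).+1.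
  elim: r {rN} => [|r IH].
    by rewrite big_ord0 addn0 qpoch0 muln0 expr0 !mul1r divff.
  rewrite big_ord_recr /= IH !addnS !addSn !qpochS mulnS.
  have := P (N + r)%N; have := q1 (ltn0Sn (N + r)); have := q1 (ltn0Sn (N + r).+1).
  have : q ^+ N != 0 by rewrite expf_neq0.
  rewrite !exprS !exprD.
  by move: (q ^+ N) => x h1 h2 h3 h4; field; rewrite h1 h2 h3 h4.
have ->: (- q ^+ r.+1) ^+ (N - r) = (-1) ^+ r * q ^+ (r.+1 * (N - r)) * (-1) ^+ N.
  rewrite [LHS]exprNn -exprM [RHS]mulrAC -exprD; congr (_ * _).
  by rewrite -[LHS]signr_odd -[RHS]signr_odd oddB // oddD addbC.
rewrite [(- q) ^+ N]exprNn /al /row_value.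
have e : q ^+ (2 * r ^ 2 + r) * q ^+ r * q ^+ (r.+1 * (N - r)) =
  q ^+ N * q ^+ (r ^ 2) * q ^+ (N.+1 * r).
  by rewrite -!exprD; congr (_ ^+ _); nia.
have h1 := P N.+1; have h2 := P (N + r).+1.
set A := qpoch _ _ N; set B := qpoch (q ^- N) _ _.
transitivity ((1 - q ^+ (2 * r).+1) * pentsum r * A * B * (-1) ^+ r *
    (-1) ^+ N / qpoch q q (N + r).+1 *
    (q ^+ (2 * r ^ 2 + r) * q ^+ r * q ^+ (r.+1 * (N - r)))).
  by ring.
by rewrite e; field; rewrite h1 h2.
Qed.

End Bailey.

(** * The double sum as a sum over rows *)

Lemma sumz_pos (V : zmodType) r (f : int -> V) : sumz (- r%:Z) r%:Z f = symsum r f.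
Proof.
rewrite /sumz (_ : (- r%:Z <= r%:Z)%R); last by lia.
have -> : `|(r%:Z - - r%:Z + 1)%R|%N = (2 * r).+1 by lia.
elim: r => [|r IH]; first by rewrite /symsum big_ord1 big_ord0 !addr0 oppr0.
have -> : ((2 * r.+1).+1 = (2 * r).+3)%N by lia.
rewrite symsumS -IH big_ord_recl big_ord_recr /=.
rewrite [LHS]addrC -[LHS]addrA; congr (_ + (_ + _)).
- by apply: eq_bigr => i _; congr f; rewrite /bump; lia.
- by congr f; rewrite /bump; lia.
- by congr f; lia.
Qed.

Lemma sumz_neg (V : zmodType) r (f : int -> V) :
  sumz (- - r.+1%:Z) (- r.+1%:Z) f = - symsum r f.
Proof.
rewrite sumz_rev; last by lia.
by rewrite -sumz_pos; congr (- sumz _ _ _); lia.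
Qed.

Lemma sumz_outer (V : zmodType) n (f : int -> V) :
  sumz (- n.+1%:Z) (n.+1%:Z - 1) f = \sum_(r < n.+1) (f r%:Z + f (- r.+1%:Z)).
Proof.
rewrite /sumz (_ : (- n.+1%:Z <= n.+1%:Z - 1)%R); last by lia.
have -> : `|(n.+1%:Z - 1 - - n.+1%:Z + 1)%R|%N = (2 * n.+1)%N by lia.
elim: (n.+1) => [|m IH]; first by rewrite !big_ord0.
have -> : ((2 * m.+1) = (2 * m).+2)%N by lia.
rewrite [RHS]big_ord_recr -IH big_ord_recl big_ord_recr /=.
rewrite [LHS]addrC -[LHS]addrA; congr (_ + (_ + _)).
- by apply: eq_bigr => i _; congr f; rewrite /bump; lia.
- by congr f; rewrite /bump; lia.
- by congr f; lia.
Qed.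

Lemma eq_sumz (V : zmodType) a b (f g : int -> V) : f =1 g -> sumz a b f = sumz a b g.
Proof. by move=> fg; rewrite /sumz; case: ifP => _; [|congr (- _)]; apply: eq_bigr. Qed.

(** The terms k = r and k = -(r+1) of the double sum run over the same j, the
    second one with opposite sign.  The function g stands for e -> q^e, for
    e -> e q^e, or for a shifted power of the indeterminate. *)
Definition theta_row (A : pzRingType) r (g : int -> A) : A := symsum r (fun j =>
  (-1) ^+ (r + `|j|) * (g (r%:Z ^+ 2 - pentz j) - g (r.+1%:Z ^+ 2 - pentz j))).

Lemma sign_int (A : unitRingType) (k : int) : (-1) ^ k = (-1) ^+ `|k|%N :> A.
Proof.
case: k => k; first by [].
by rewrite NegzE -exprnN abszN absz_nat -exprVn invrN1.
Qed.

Lemma sumz_theta (A : unitRingType) n (g : int -> A) :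
  sumz (- n.+1%:Z) (n.+1%:Z - 1) (fun k => sumz (- k) k (fun j =>
    (sgnz k)%:~R * (-1) ^ (k + j) * g (k ^+ 2 - pentz j))) =
  \sum_(r < n.+1) theta_row r g.
Proof.
have sg (r : nat) j : (-1) ^ (r%:Z + j) = (-1) ^+ (r + `|j|) :> A.
  by rewrite sign_int -[LHS]signr_odd -[RHS]signr_odd; congr (_ ^+ nat_of_bool _); lia.
rewrite sumz_outer; apply: eq_bigr => r _.
rewrite sumz_pos sumz_neg [- symsum _ _](raddf_symsum -%R) symsumD /=; apply: eq_symsum => j _.
have sg' : (-1) ^ (- r.+1%:Z + j) = - (-1) ^+ (r + `|j|) :> A.
  rewrite sign_int -[RHS]mulN1r -exprS -[LHS]signr_odd -[RHS]signr_odd.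
  by congr (_ ^+ nat_of_bool _); lia.
by rewrite sg sg' sqrrN /sgnz oppr_ge0 !lez_nat leq0n ltn0 mul1r mulrN1z mulrNN mul1r mulrBr.
Qed.

(** * Products over roots of unity *)

Section Roots.
Variables (F : fieldType) (n : nat) (z : F).
Hypothesis hz : n.+1.-primitive_root z.

Lemma prim_expr_neq1 i : (0 < i < n.+1)%N -> 1 - z ^+ i != 0.
Proof.
move=> /andP[i0 iN]; rewrite subr_eq0 eq_sym -(prim_order_dvd hz).
by rewrite gtnNdvd.
Qed.

Lemma prim_neq0 : z != 0.
Proof. by rewrite -unitfE -(unitrX_pos _ (ltn0Sn n)) (prim_expr_order hz) unitr1. Qed.

Lemma prod_sub_prim x : (x - 1) * \prod_(i < n) (x - z ^+ i.+1) = x ^+ n.+1 - 1.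
Proof.
have := congr1 (fun p => p.[x]) (factor_Xn_sub_1 hz).
rewrite !hornerE big_mkord horner_prod big_ord_recl /= !hornerE expr0 => <-.
by congr (_ * _); apply: eq_bigr => i _; rewrite !hornerE.
Qed.

(** The value at 1 of (X^(n+1) - 1) / (X - 1) = 1 + X + ... + X^n. *)
Lemma qpoch_prim : qpoch z z n = n.+1%:R.
Proof.
have e : ('X - 1) * \prod_(i < n) ('X - (z ^+ i.+1)%:P) = 'X^(n.+1) - 1 :> {poly F}.
  by rewrite -(factor_Xn_sub_1 hz) big_mkord big_ord_recl expr0.
rewrite subrX1 in e; move/mulfI: e; rewrite polyXsubC_eq0 => /(_ isT).
move=> /(congr1 (fun p => p.[1])).
rewrite horner_prod horner_sum => e.
transitivity (\prod_(i < n) ('X - (z ^+ i.+1)%:P).[1]).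
  by apply: eq_bigr => i _; rewrite !hornerE exprS.
rewrite e -[RHS]/(_ *+ _) -[in RHS](card_ord n.+1) -sumr_const.
by apply: eq_bigr => i _; rewrite !hornerE expr1n.
Qed.

(** The product of all -1 - z^i, i from 0 to n, is (-1)^(n+1) - 1 = -2; its factor
    for i = 0 is -2. *)
Lemma qpochN_prim_odd : 2%:R != 0 :> F -> odd n.+1 -> qpoch (- z) z n = 1.
Proof.
move=> two0 nodd; have := prod_sub_prim (-1).
have -> : \prod_(i < n) (-1 - z ^+ i.+1) = qpoch (- z) z n.
  have -> : qpoch (- z) z n = (-1) ^+ n * qpoch (- z) z n.
    by rewrite -signr_odd; move: nodd => /= /negbTE ->; rewrite mul1r.
  rewrite /qpoch -[(-1) ^+ n](_ : \prod_(i < n) (-1) = _); last by rewrite prodr_const card_ord.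
  by rewrite -big_split /=; apply: eq_bigr => i _; rewrite exprS; ring.
rewrite -signr_odd nodd expr1 -opprD -[1 + 1]/(2%:R) => h.
by apply: (mulfI (x := - 2%:R)); rewrite ?oppr_eq0 // h mulr1.
Qed.
End Roots.

Lemma prim_half (F : fieldType) h (z : F) : (h.+1 * 2).-primitive_root z -> z ^+ h.+1 = -1.
Proof.
move=> hz; have := prim_expr_order hz; rewrite exprM => /eqP.
rewrite sqrf_eq1 => /orP[|/eqP //].
by rewrite -(prim_order_dvd hz) gtnNdvd // muln2 -addnn; lia.
Qed.

(** Since z^(h+1) = -1, the factors 1 + z^i are the 1 - z^(i+h+1).  Without the
    vanishing factor i = h + 1, they are all the 1 - z^j with 0 < j < 2h + 2 except
    j = h + 1, where 1 - z^j = 2. *)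
Lemma qpochN_prim_even (F : fieldType) h (z : F) : (h.+1 * 2).-primitive_root z ->
  2%:R * \prod_(i < (h.+1 * 2).-1 | i != h :> nat) (1 + z ^+ i.+1) = (h.+1 * 2)%:R.
Proof.
move=> hz; have zh := prim_half hz.
have -> : (h.+1 * 2).-1 = (h.+1 + h)%N by lia.
rewrite big_split_ord /= [X in _ * (X * _)]big_mkcond big_ord_recr /= eqxx mulr1.
have := hz; have {1 2}-> : (h.+1 * 2 = (h.+1 + h).+1)%N by lia.
move=> /qpoch_prim <-.
rewrite qpochD qpochS -exprS zh opprK -[1 + 1]/(2%:R) [qpoch _ _ _ * _]mulrC -mulrA; congr (_ * _).
rewrite mulrC; congr (_ * _).
  apply: eq_big => i; first by have := ltn_ord i; lia.
  by move=> _; rewrite -addnS exprD zh mulN1r exprS.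
apply: eq_bigr => i _.
rewrite ifT; last by have := ltn_ord i; lia.
by rewrite mulrN1 mulNr opprK exprS.
Qed.

Lemma theta_row_exp (F : fieldType) (q : F) r : q != 0 ->
  theta_row r (fun e => q ^ e) = row_value q r.
Proof.
move=> q0; have -> : row_value q r =
    ((-1) ^+ r * q ^+ (r ^ 2) * (1 - q ^+ (2 * r).+1)) * pentsum q r.
  by rewrite /row_value mulrAC.
rewrite /pentsum mulr_symsumr /theta_row /=.
apply: eq_symsum => j _ /=.
have -> : r.+1%:Z ^+ 2 - pentz j = (r ^ 2)%N%:Z + (2 * r).+1%:Z - pentz j by lia.
rewrite -PoszD !expfzDr // -!exprnP exprD exprD.
by rewrite mulnn; ring.
Qed.

(** * Symmetry under reflection and differentiation *)

(** The hypothesis makes f (N - r) - f r independent of r; this difference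
    changes sign under r -> N - r, so it is 0. *)
Lemma reflect_of_increments (A : numDomainType) N (f : nat -> A) :
  (forall r, (r < N)%N -> f r.+1 - f r = f (N - r.+1)%N - f (N - r)%N) ->
  forall r, (r <= N)%N -> f (N - r)%N = f r.
Proof.
move=> H.
have D r : (r <= N)%N -> f (N - r)%N - f r = f N - f 0%N.
  elim: r => [|r IH] rN; first by rewrite subn0.
  rewrite -IH 1?ltnW //; have := H _ rN.
  by move: (f _) (f _) (f _) (f _) => a b c d /eqP; rewrite subr_eq => /eqP ->; ring.
have D0 : f N - f 0%N = 0.
  have := D N (leqnn N); rewrite subnn => /eqP.
  by rewrite -opprB eq_sym -addr_eq0 -mulr2n mulrn_eq0 /= => /eqP.
by move=> r rN; apply/eqP; rewrite -subr_eq0 D // D0.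
Qed.

(** * The identity as an identity of polynomials *)

Lemma deriv_common_root (F : fieldType) (a b c d : {poly F}) z :
  a * b = c * d -> a.[z] = 0 -> d.[z] = 0 -> a^`().[z] * b.[z] = c.[z] * d^`().[z].
Proof.
move=> /(congr1 (fun p => p^`().[z])); rewrite !derivM !hornerD !hornerM.
by move=> h a0 d0; move: h; rewrite a0 d0 mul0r mulr0 addr0 add0r.
Qed.

Section Poly.
Variables (F : numFieldType) (N : nat).
Local Notation n := N.+1.
Local Notation M := (2 * n ^ 2)%N.

(** The product over i < r in [finite_bailey_identity], multiplied by the common
    denominator, which is the case r = 0. *)
Definition ratio_poly r : {poly F} :=
  \prod_(i < N) (if (i < r)%N then 'X^n - 'X^(i.+1) else 1 - 'X^(n + i.+1)).

(** The common factors of [ratio_poly k] and [ratio_poly k.+1]. *)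
Definition slope_poly k : {poly F} :=
  \prod_(i < N | i != k :> nat)
     (if (i < k)%N then 'X^n - 'X^(i.+1) else 1 - 'X^(n + i.+1)).

(** The two factors that differ satisfy
    (X^n - X^i) - (1 - X^(n+i)) = (X^n - 1) (1 + X^i) with i = r + 1; so all the
    [ratio_poly r] agree at n-th roots of unity, and their first-order
    differences are explicit. *)
Lemma ratio_polyS r : (r < N)%N ->
  ratio_poly r.+1 = ratio_poly r + ('X^n - 1) * (slope_poly r * (1 + 'X^(r.+1))).
Proof.
move=> rN; rewrite /ratio_poly (bigD1 (Ordinal rN)) // [in RHS](bigD1 (Ordinal rN)) //=.
rewrite ltnn leqnn.
set A := \prod_(_ < _ | _) _; set B := \prod_(_ < _ | _) _.
have -> : A = slope_poly r.
  by apply: eq_bigr => i; rewrite -val_eqE /= ltnS leq_eqVlt => /negbTE ->.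
have -> : B = slope_poly r by apply: eq_bigl.
by rewrite exprD; ring.
Qed.

Lemma ratio_poly_sum r : (r <= N)%N ->
  ratio_poly r = ratio_poly 0 +
    ('X^n - 1) * \sum_(i < r) slope_poly i * (1 + 'X^(i.+1)).
Proof.
elim: r => [|r IH] rN; first by rewrite big_ord0 mulr0 addr0.
by rewrite ratio_polyS // IH 1?ltnW // [in RHS]big_ord_recr [in RHS]mulrDr addrA.
Qed.

(** The shift by M makes all the exponents nonnegative, so the absolute value is
    only a conversion to natural numbers ([row_exponent_ge0]). *)
Definition row_poly r : {poly F} := theta_row r (fun e => 'X^(`|e + M%:Z|)).

Lemma row_exponent_ge0 r j : (r <= N)%N -> (`|j| <= r)%N ->
  0 <= r%:Z ^+ 2 - pentz j + M%:Z /\ 0 <= r.+1%:Z ^+ 2 - pentz j + M%:Z.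
Proof. by have := double_pentz j; nia. Qed.

Lemma horner_row_poly r x : (r <= N)%N -> x != 0 -> (row_poly r).[x] = x ^+ M * row_value x r.
Proof.
move=> rN x0; rewrite -theta_row_exp // /row_poly /theta_row mulr_symsumr.
rewrite -[LHS]/(horner_eval x _) raddf_symsum; apply: eq_symsum => j jr /=.
have [e1 e2] := row_exponent_ge0 rN jr.
have E (e : int) : 0 <= e + M%:Z -> x ^+ `|e + M%:Z| = x ^+ M * x ^ e.
  by move=> e0; rewrite exprnP gez0_abs // expfzDr // mulrC.
move: (2 * n ^ 2)%N E e1 e2 => m E e1 e2.
by rewrite /horner_eval hornerM hornerD hornerN !hornerXn !E // horner_exp hornerN hornerC; ring.
Qed.

(** Each factor of (q^-N)_k is multiplied by q^n, and each summand is completed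
    to the common factor q^(n^2). *)
Definition lhs_poly : {poly F} := \sum_(k < n) qpoch (- 'X) 'X k *
  (\prod_(i < k) ('X^n - 'X^(i.+1))) * 'X^k * 'X^(n * (n - k)).

Lemma horner_qpoch (a b : {poly F}) k x : (qpoch a b k).[x] = qpoch a.[x] b.[x] k.
Proof. by rewrite horner_prod; apply: eq_bigr => i _; rewrite !hornerE. Qed.

Lemma horner_lhs_poly x : x != 0 -> lhs_poly.[x] =
  x ^+ (n * n) * \sum_(k < n) qpoch (- x) x k * qpoch (x ^- N) x k * x ^+ k.
Proof.
move=> x0; rewrite horner_sum mulr_sumr; apply: eq_bigr => k _.
rewrite !hornerM !hornerXn horner_qpoch horner_prod hornerN hornerX.
have -> : (n * n = n * k + n * (n - k))%N by rewrite -mulnDr subnKC // ltnW.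
have -> : \prod_(i < k) ('X^n - 'X^(i.+1)).[x] = x ^+ (n * k) * qpoch (x ^- N) x k.
  elim: (nat_of_ord k) => [|m IH]; first by rewrite big_ord0 qpoch0 muln0 mul1r.
  rewrite big_ord_recr /= IH qpochS mulnS exprD hornerD hornerN !hornerXn !exprS; field.
  by rewrite expf_neq0.
by rewrite exprD; ring.
Qed.

Lemma slope_polyM r : (r < N)%N -> slope_poly r * (1 - 'X^(n + r.+1)) = ratio_poly r.
Proof.
by move=> rN; rewrite /ratio_poly (bigD1 (Ordinal rN)) //= ltnn mulrC; congr (_ * _).
Qed.

Lemma horner_ratio_poly r x : (forall i, (0 < i)%N -> 1 - x ^+ i != 0) -> (r <= N)%N ->
  (ratio_poly r).[x] = (ratio_poly 0).[x] *
    \prod_(i < r) ((x ^+ n - x ^+ i.+1) / (1 - x ^+ (n + i.+1))).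
Proof.
move=> x1; elim: r => [|r IH] rN; first by rewrite big_ord0 mulr1.
rewrite big_ord_recr /= [RHS]mulrA -IH 1?ltnW // ratio_polyS // -slope_polyM //.
rewrite !(hornerD, hornerM, hornerN, hornerXn, hornerC) exprD.
by field; rewrite -exprD x1.
Qed.

Lemma poly_eq_at_nat (p q : {poly F}) :
  (forall m, (1 < m)%N -> p.[m%:R] = q.[m%:R]) -> p = q.
Proof.
move=> pq; apply/eqP; rewrite -subr_eq0; apply/eqP.
apply: (@roots_geq_poly_eq0 _ _ [seq i.+2%:R | i <- iota 0 (size (p - q))]).
- apply/allP => _ /mapP[i _ ->].
  by rewrite /root hornerD hornerN pq // subrr.
- rewrite map_inj_uniq ?iota_uniq // => i j /eqP; rewrite eqr_nat => /eqP [].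
  by [].
- by rewrite size_map size_iota.
Qed.

(** No integer greater than 1 is a root of unity, so the generic identity holds
    at infinitely many points. *)
Lemma finite_bailey_identity_poly :
  'X^M * lhs_poly * qpoch 'X 'X n * ratio_poly 0 =
  'X^(n * n) * qpoch (- 'X) 'X N * (- 'X) ^+ N * \sum_(r < n) row_poly r * ratio_poly r.
Proof.
apply: poly_eq_at_nat => m m1; set x : F := m%:R.
have x0 : x != 0 by rewrite pnatr_eq0; lia.
have x1 i : (0 < i)%N -> 1 - x ^+ i != 0.
  move=> i0; rewrite subr_eq0 /x -natrX eq_sym pnatr_eq1.
  by rewrite -(expn0 m) eqn_exp2l //; lia.
rewrite !hornerM !horner_qpoch !horner_exp hornerN !hornerX.
rewrite horner_lhs_poly // finite_bailey_identity // horner_sum.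
under [X in _ = _ * X]eq_bigr => r _.
  have rN : (r <= N)%N by rewrite -ltnS.
  rewrite hornerM horner_row_poly // horner_ratio_poly //; over.
have -> : \sum_(r < n) x ^+ M * row_value x r * ((ratio_poly 0).[x] *
    \prod_(i < r) ((x ^+ n - x ^+ i.+1) / (1 - x ^+ (n + i.+1)))) =
   x ^+ M * (ratio_poly 0).[x] * \sum_(r < n) row_value x r *
    \prod_(i < r) ((x ^+ n - x ^+ i.+1) / (1 - x ^+ (n + i.+1))).
  by rewrite mulr_sumr; apply: eq_bigr => r _; ring.
have := qpoch_qq_neq0 x1 n; move: (x ^+ M) => y h.
by field.
Qed.

Lemma horner_deriv_row_poly r x : (r <= N)%N -> x != 0 ->
  x * (row_poly r)^`().[x] =
    x ^+ M * (theta_row r (fun e => e%:~R * x ^ e) + M%:R * row_value x r).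
Proof.
move=> rN x0; rewrite -theta_row_exp // /row_poly /theta_row !mulr_symsumr.
rewrite [_^`()]raddf_symsum -[_.[_]]/(horner_eval x _) raddf_symsum mulr_symsumr.
rewrite symsumD mulr_symsumr; apply: eq_symsum => j jr /=.
have [e1 e2] := row_exponent_ge0 rN jr.
have E (e : int) : 0 <= e + M%:Z ->
    x * ('X^(`|e + M%:Z|))^`().[x] = x ^+ M * ((e%:~R + M%:R) * x ^ e).
  move=> e0; rewrite derivXn hornerMn hornerXn.
  have -> (k : nat) : x * (x ^+ k.-1 *+ k) = k%:R * x ^+ k.
    by case: k => [|k]; rewrite ?mulr0n ?mulr0 ?mul0r // mulrnAr -exprS mulr_natl.
  have -> : (absz (e + M%:Z))%:R = e%:~R + M%:R :> F.
    by rewrite pmulrn gez0_abs // mulrzDr.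
  by rewrite exprnP gez0_abs // expfzDr // -exprnP; ring.
move: M E e1 e2 => m E e1 e2.
rewrite /horner_eval -polyC1 -polyCN -polyC_exp mul_polyC derivZ derivB.
rewrite hornerZ hornerD hornerN mulrCA mulrBr !E //; ring.
Qed.

(** * Evaluation at a root of unity of odd order *)

Section Values.
Variable z : F.
Hypothesis hz : n.-primitive_root z.

Let zn : z ^+ n = 1 := prim_expr_order hz.
Let z0 : z != 0 := prim_neq0 hz.

Lemma ratio_poly_prim r : (ratio_poly r).[z] = n%:R.
Proof.
rewrite -(qpoch_prim hz) horner_prod; apply: eq_bigr => i _.
by rewrite -exprS; case: ifP => _; rewrite !(hornerD, hornerN, hornerXn, hornerC) ?exprD zn ?mul1r.
Qed.

Lemma slope_poly_prim k : (k < N)%N -> (slope_poly k).[z] = n%:R / (1 - z ^+ k.+1).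
Proof.
move=> kN; rewrite -(ratio_poly_prim k) -slope_polyM //.
rewrite hornerM hornerD hornerN hornerXn hornerC exprD zn mul1r mulfK //.
by apply: (prim_expr_neq1 hz).
Qed.

Lemma lhs_poly_prim :
  lhs_poly.[z] = \sum_(k < n) qpoch (z ^+ 2) (z ^+ 2) k * z ^+ k.
Proof.
rewrite horner_lhs_poly // exprM zn expr1n mul1r; apply: eq_bigr => k _.
have -> : z ^- N = z.
  by apply: (mulfI (expf_neq0 N z0)); rewrite divff ?expf_neq0 // -exprSr zn.
by rewrite qpoch_sqr; ring.
Qed.

Lemma pentz_shift j : odd n -> z ^ (- pentz (j + n%:Z)) = z ^ (- pentz j).
Proof.
move=> nodd; have [h eh] : exists h, n = (2 * h).+1 by exists n./2; lia.
have -> : - pentz (j + n%:Z) = - pentz j + n%:Z * - (3 * j + 3 * h%:Z + 2).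
  have e : (2 : int) != 0 by [].
  by apply: (mulfI e); rewrite mulrDr !mulrN double_pentz double_pentz eh; lia.
by rewrite expfzDr // -exprz_exp -exprnP zn exp1rz mulr1.
Qed.

(** The summand (-1)^j z^(-j(3j+1)/2) changes sign under j -> j + n, by
    [pentz_shift] and because n is odd.  Hence the terms j = r + 1 and j = -(r+1)
    that S_{r+1} has and S_r has not are minus those that S_{N-r} has and
    S_{N-r-1} has not. *)
Lemma pentsum_reflect r : odd n -> (r <= N)%N -> pentsum z (N - r) = pentsum z r.
Proof.
move=> nodd; apply: reflect_of_increments => {}r rN.
have -> : (N - r = (N - r.+1).+1)%N by lia.
rewrite /pentsum !symsumS [in LHS]addrAC subrr add0r.
rewrite [in RHS]opprD [in RHS]addrA subrr add0r.
have e1 : r.+1%:Z = - (N - r.+1).+1%:Z + n%:Z by lia.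
have e2 : (N - r.+1).+1%:Z = - r.+1%:Z + n%:Z by lia.
rewrite [in pentz r.+1]e1 [in pentz (N - r.+1).+1]e2 !pentz_shift // !abszN !absz_nat.
have -> : (-1) ^+ (N - r.+1).+1 = - (-1) ^+ r.+1 :> F.
  rewrite -[LHS]signr_odd -[(-1) ^+ r.+1]signr_odd -[RHS]mulN1r -exprS -[RHS]signr_odd.
  by congr (_ ^+ nat_of_bool _); lia.
ring.
Qed.

Lemma row_reflect r : odd n -> (r <= N)%N -> row_value z (N - r) = - row_value z r.
Proof.
move=> nodd rN; rewrite /row_value pentsum_reflect //.
have -> : (-1) ^+ (N - r) = (-1) ^+ r :> F.
  by rewrite -[LHS]signr_odd -[RHS]signr_odd; congr (_ ^+ nat_of_bool _); lia.
have e1 : z ^+ ((N - r) ^ 2) = z ^+ (r ^ 2) * z ^+ (2 * r).+1.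
  apply: (mulIf (expf_neq0 ((N - r) * r.+1) z0)).
  rewrite -!exprD.
  have -> : ((N - r) ^ 2 + (N - r) * r.+1 = n * (N - r))%N by nia.
  have -> : (r ^ 2 + (2 * r).+1 + (N - r) * r.+1 = n * r.+1)%N by nia.
  by rewrite !exprM zn !expr1n.
have e2 : z ^+ (2 * r).+1 * z ^+ (2 * (N - r)).+1 = 1.
  rewrite -exprD.
  have -> : ((2 * r).+1 + (2 * (N - r)).+1 = n * 2)%N by lia.
  by rewrite exprM zn expr1n.
rewrite e1.
transitivity ((-1) ^+ r * z ^+ (r ^ 2) * pentsum z r *
  (z ^+ (2 * r).+1 - z ^+ (2 * r).+1 * z ^+ (2 * (N - r)).+1)); first by ring.
by rewrite e2; ring.
Qed.

Lemma sum_antisym (f : nat -> F) : (forall r, (r <= N)%N -> f (N - r)%N = - f r) ->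
  \sum_(r < n) f r = 0.
Proof.
move=> fN; have e : \sum_(r < n) f r = - \sum_(r < n) f r.
  rewrite {1}(reindex_inj rev_ord_inj) -sumrN; apply: eq_bigr => r _ /=.
  by rewrite subSS fN // -ltnS.
by apply/eqP; rewrite -[_ == 0](mulrn_eq0 _ 2) mulr2n {1}e addNr.
Qed.

(** The quotient (1 + x) / (1 - x) changes sign under x -> 1/x, which exchanges
    z^i and z^(n-i). *)
Lemma slope_sum_reflect r : (r <= N)%N ->
  \sum_(i < N - r) (1 + z ^+ i.+1) / (1 - z ^+ i.+1) =
  \sum_(i < r) (1 + z ^+ i.+1) / (1 - z ^+ i.+1).
Proof.
pose c r := \sum_(i < r) (1 + z ^+ i.+1) / (1 - z ^+ i.+1).
apply: (@reflect_of_increments _ N c) => {}r rN.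
have -> : (N - r = (N - r.+1).+1)%N by lia.
rewrite /c !big_ord_recr /= addrAC subrr add0r opprD addrA subrr add0r.
have e : z ^+ r.+1 * z ^+ (N - r.+1).+1 = 1.
  by rewrite -exprD (_ : (_ + _ = n)%N) //; lia.
have h1 : 1 - z ^+ r.+1 != 0 by apply: (prim_expr_neq1 hz); lia.
have h2 : 1 - z ^+ (N - r.+1).+1 != 0 by apply: (prim_expr_neq1 hz); lia.
apply: (mulIf h1); apply: (mulIf h2); move: e h1 h2.
move: (z ^+ r.+1) (z ^+ (N - r.+1).+1) => a b e h1 h2.
transitivity ((1 + a) * (1 - b)); first by field.
transitivity (- ((1 + b) * (1 - a))); last by field.
transitivity (1 - a * b + a - b); first by ring.
rewrite e; transitivity (- 1 + a * b + a - b); last by ring.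
by rewrite e; ring.
Qed.

(** The polynomial identity reads (1 - X^n) (P + B V) = B [ratio_poly 0] W, where W
    is the sum of the rows and V collects the first-order terms of the
    [ratio_poly r].  Both W and V vanish at z by the reflection, so
    comparing derivatives at z relates P(z) to W'(z) alone. *)
Lemma sum_at_odd_root : odd n ->
  \sum_(k < n) qpoch (z ^+ 2) (z ^+ 2) k * z ^+ k.+1 =
  - 1 / n%:R ^+ 2 * \sum_(r < n) theta_row r (fun e => e%:~R * z ^ e).
Proof.
move=> nodd.
pose W := \sum_(r < n) row_poly r.
pose V := \sum_(r < n) row_poly r * \sum_(i < r) slope_poly i * (1 + 'X^(i.+1)).
pose B : {poly F} := 'X^(n * n) * qpoch (- 'X) 'X N * (- 'X) ^+ N.
pose P : {poly F} := 'X^M * lhs_poly * qpoch 'X 'X N * ratio_poly 0.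
have rowz r : (r <= N)%N -> (row_poly r).[z] = z ^+ M * row_value z r.
  by move=> rN; apply: horner_row_poly.
have W0 : W.[z] = 0.
  rewrite horner_sum; transitivity (\sum_(r < n) z ^+ M * row_value z r).
    by apply: eq_bigr => r _; rewrite rowz // -ltnS.
  by rewrite -mulr_sumr (sum_antisym (f := row_value z)) ?mulr0 // => r rN; apply: row_reflect.
have V0 : V.[z] = 0.
  pose c r := \sum_(i < r) (1 + z ^+ i.+1) / (1 - z ^+ i.+1).
  rewrite horner_sum; transitivity (\sum_(r < n) z ^+ M * n%:R * (row_value z r * c r)).
    apply: eq_bigr => r _; have rN : (r <= N)%N by rewrite -ltnS.
    rewrite hornerM rowz // horner_sum.
    transitivity (z ^+ M * row_value z r * (n%:R * c r)); last by ring.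
    congr (_ * _); rewrite mulr_sumr; apply: eq_bigr => i _.
    rewrite hornerM slope_poly_prim ?(leq_trans (ltn_ord i)) //.
    by rewrite !(hornerD, hornerXn, hornerC); ring.
  rewrite -mulr_sumr (sum_antisym (f := fun r => row_value z r * c r)) ?mulr0 // => r rN.
  by rewrite row_reflect // [c _]slope_sum_reflect // mulNr.
have main : (1 - 'X^n) * (P + B * V) = B * ratio_poly 0 * W.
  have := finite_bailey_identity_poly; rewrite qpochS -exprS.
  have -> : \sum_(r < n) row_poly r * ratio_poly r = ratio_poly 0 * W + ('X^n - 1) * V.
    rewrite !mulr_sumr -big_split; apply: eq_bigr => r _ /=.
    by rewrite {1}ratio_poly_sum -1?ltnS //; ring.
  rewrite -/B => h.
  transitivity ('X^M * lhs_poly * (qpoch 'X 'X N * (1 - 'X^n)) * ratio_poly 0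
     + (1 - 'X^n) * B * V); first by rewrite /P; ring.
  by rewrite h; ring.
have A0 : (1 - 'X^n : {poly F}).[z] = 0.
  by rewrite hornerD hornerN hornerXn hornerC zn subrr.
have := deriv_common_root main A0 W0.
have -> : (1 - 'X^n : {poly F})^`().[z] = - (n%:R * z^-1).
  rewrite derivB derivC derivXn sub0r hornerN hornerMn hornerXn /=.
  by rewrite -[z ^+ N](mulfK z0) -exprSr zn mul1r mulr_natl.
rewrite hornerD [(B * V).[z]]hornerM V0 mulr0 addr0 => /(congr1 ( *%R z)).
have -> : z * ((B * ratio_poly 0).[z] * W^`().[z]) =
    (B * ratio_poly 0).[z] * (z ^+ M * \sum_(r < n) theta_row r (fun e => e%:~R * z ^ e)).
  rewrite mulrCA; congr (_ * _).
  rewrite raddf_sum horner_sum mulr_sumr.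
  transitivity (\sum_(r < n) (z ^+ M * theta_row r (fun e => e%:~R * z ^ e)
       + z ^+ M * M%:R * row_value z r)).
    apply: eq_bigr => r _; rewrite horner_deriv_row_poly -1?ltnS //.
    by rewrite mulrDr !mulrA.
  rewrite big_split /= -mulr_sumr -[X in _ + X]mulr_sumr.
  rewrite (sum_antisym (f := row_value z)) ?mulr0 ?addr0 // => r rN.
  exact: row_reflect.
rewrite /B /P !hornerM !horner_qpoch !horner_exp hornerN !hornerX.
rewrite (qpochN_prim_odd hz) ?pnatr_eq0 // (qpoch_prim hz) ratio_poly_prim lhs_poly_prim.
rewrite [z ^+ (n * n)]exprM zn expr1n exprNn -signr_odd.
have -> : odd N = false by move: nodd => /= /negbTE.
have -> : z ^+ N = z^-1 by rewrite -[z ^+ N](mulfK z0) -exprSr zn mul1r.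
have -> : \sum_(k < n) qpoch (z ^+ 2) (z ^+ 2) k * z ^+ k.+1 =
    z * \sum_(k < n) qpoch (z ^+ 2) (z ^+ 2) k * z ^+ k.
  by rewrite mulr_sumr; apply: eq_bigr => k _; rewrite [z ^+ k.+1]exprS mulrCA.
have n0 : n%:R != 0 :> F by rewrite pnatr_eq0.
have zM0 : z ^+ M != 0 by rewrite expf_neq0.
move: (\sum_(k < n) _) (\sum_(k < n) _) (z ^+ M) zM0 => T S y y0 e.
have h : n%:R * y * z^-1 * (n%:R ^+ 2 * z * S + T) = 0.
  move/eqP: e; rewrite -subr_eq0 => /eqP e; rewrite -[RHS]oppr0 -[in RHS]e.
  by rewrite expr0; field.
move/eqP: h; rewrite mulf_eq0 !mulf_eq0 invr_eq0 (negbTE z0) (negbTE n0) (negbTE y0) /=.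
by rewrite addr_eq0 => /eqP h; rewrite -[T]opprK -h; move: n%:R n0 => m m0; field.
Qed.

End Values.
End Poly.

(** * Evaluation at a root of unity of even order *)

(** Both 1 - X^n and (-X)_N are divisible by 1 + X^(n/2), which vanishes at z.
    The cofactors take the values 2 and n/2 there ([qpochN_prim_even]). *)
Lemma sum_at_even_root (F : numFieldType) N h (z : F) : N.+1 = (h.+1 * 2)%N ->
  N.+1.-primitive_root z ->
  \sum_(k < N.+1) qpoch (z ^+ 2) (z ^+ 2) k * z ^+ k.+1 =
  - 1 / 4%:R * \sum_(r < N.+1) theta_row r (fun e => z ^ e).
Proof.
move=> eN hz.
have [zh hB] : z ^+ h.+1 = -1 /\
    2%:R * \prod_(i < N | i != h :> nat) (1 + z ^+ i.+1) = N.+1%:R.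
  rewrite eN -[N]/(N.+1.-1) eN; rewrite eN in hz.
  by split; [apply: prim_half | apply: qpochN_prim_even].
have zn := prim_expr_order hz; have z0 := prim_neq0 hz.
have hN : (h < N)%N by lia.
have n0 : N.+1%:R != 0 :> F by rewrite pnatr_eq0.
pose C : {poly F} := \prod_(i < N | i != h :> nat) (1 + 'X^(i.+1)).
have CE : qpoch (- 'X) 'X N = (1 + 'X^(h.+1)) * C.
  rewrite /qpoch (bigD1 (Ordinal hN)) //= mulNr opprK -exprS; congr (_ * _).
  by apply: eq_big => // i _; rewrite mulNr opprK -exprS.
have Cz : C.[z] = N.+1%:R / 2%:R.
  rewrite -hB mulrC mulKf ?pnatr_eq0 // horner_prod.
  by apply: eq_bigr => i _; rewrite hornerD hornerXn hornerC.
have D0 : 1 + 'X^(h.+1) != 0 :> {poly F}.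
  apply/eqP => /(congr1 (fun p => p.[1])).
  by rewrite hornerD hornerXn hornerC expr1n horner0 => /eqP; rewrite -mulr2n pnatr_eq0.
have := finite_bailey_identity_poly F N; rewrite CE qpochS -exprS => e.
(* 1 - X^n and (-X)_N share the factor that vanishes at z *)
have XE : 1 - 'X^(N.+1) = (1 + 'X^(h.+1)) * (1 - 'X^(h.+1)) :> {poly F}.
  by rewrite eN exprM; ring.
have {e} : 'X^(2 * N.+1 ^ 2) * lhs_poly F N * qpoch 'X 'X N * (1 - 'X^(h.+1)) * ratio_poly F N 0 =
   'X^(N.+1 * N.+1) * C * (- 'X) ^+ N * \sum_(r < N.+1) row_poly F N r * ratio_poly F N r.
  apply: (mulfI D0); rewrite [RHS]mulrCA.
  transitivity ('X^(N.+1 * N.+1) * ((1 + 'X^(h.+1)) * C) * (- 'X) ^+ N *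
     \sum_(r < N.+1) row_poly F N r * ratio_poly F N r); last by ring.
  by rewrite -e XE; ring.
move=> /(congr1 (fun p => p.[z])).
rewrite !hornerM horner_qpoch !horner_exp hornerD !hornerN !hornerX hornerC.
rewrite hornerXn Cz zh opprK (qpoch_prim hz) (ratio_poly_prim hz) (lhs_poly_prim hz).
have -> : (\sum_(r < N.+1) row_poly F N r * ratio_poly F N r).[z] =
   z ^+ (2 * N.+1 ^ 2) * N.+1%:R * \sum_(r < N.+1) theta_row r (fun e => z ^ e).
  rewrite horner_sum mulr_sumr; apply: eq_bigr => r _.
  by rewrite hornerM horner_row_poly -1?ltnS // (ratio_poly_prim hz) theta_row_exp //; ring.
rewrite [z ^+ (N.+1 * N.+1)]exprM zn expr1n exprNn -signr_odd.
have -> : odd N by lia.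
have -> : z ^+ N = z^-1 by rewrite -[z ^+ N](mulfK z0) -exprSr zn mul1r.
have -> : \sum_(k < N.+1) qpoch (z ^+ 2) (z ^+ 2) k * z ^+ k.+1 =
    z * \sum_(k < N.+1) qpoch (z ^+ 2) (z ^+ 2) k * z ^+ k.
  by rewrite mulr_sumr; apply: eq_bigr => k _; rewrite [z ^+ k.+1]exprS mulrCA.
have zM0 : z ^+ (2 * N.+1 ^ 2) != 0 by rewrite expf_neq0.
move: (\sum_(k < N.+1) _) (\sum_(k < N.+1) _) (z ^+ (2 * N.+1 ^ 2)) zM0 => S T y y0.
move: N.+1%:R n0 => m m0 e.
have c0 : m * m * y * 2%:R / z != 0 by rewrite !mulf_neq0 ?invr_eq0 ?pnatr_eq0.
apply: (mulfI c0); transitivity (y * T * m * (1 + 1) * m); first by field.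
by rewrite e expr1; field.
Qed.

(** * Reversal of terminating sums *)

Definition reversal_term (F : fieldType) (q x : F) k :=
  qpoch q q k * qpoch x q k / (x ^+ k.+1 * q ^+ (k * k.+1)).

(** The sum telescopes: its m-th summand is d_m - d_{m+1}, where
    d_m = x q^m [reversal_term q x m] and d_0 = 1. *)
Lemma reversal_telescope (F : fieldType) (q x : F) m : q != 0 -> x != 0 ->
  \sum_(k < m) (reversal_term q x k - (1 - x) * reversal_term q (x * q) k) =
  1 - x * q ^+ m * reversal_term q x m.
Proof.
move=> q0 x0; elim: m => [|m IH].
  by rewrite big_ord0 /reversal_term !qpoch0 !expr0; field.
rewrite big_ord_recr /= {}IH /reversal_term.
have -> : (1 - x) * (qpoch q q m * qpoch (x * q) q m / ((x * q) ^+ m.+1 * q ^+ (m * m.+1))) =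
   qpoch q q m * qpoch x q m.+1 / ((x * q) ^+ m.+1 * q ^+ (m * m.+1)).
  by rewrite qpochSl; ring.
have -> : (m.+1 * m.+2 = m * m.+1 + m + m + 2)%N by lia.
rewrite !qpochS exprMn !exprD !exprS expr0.
have := expf_neq0 (m * m.+1) q0; have := expf_neq0 m q0; have := expf_neq0 m x0.
move: (q ^+ (m * m.+1)) (q ^+ m) (x ^+ m) => a b c *.
by field; apply/and5P.
Qed.

(** For x = q^-M the sum f(x) of the (x)_k obeys f(x) = 1 + (1 - x) f(x q); by
    [reversal_telescope] so does the right-hand side, the term d_M cancelling
    against its last summand, which equals it because x q^M = 1. *)
Lemma sum_qpoch_reversal (F : fieldType) (q : F) M : q != 0 ->
  \sum_(k < M.+1) qpoch (q ^- M) q k = \sum_(k < M.+1) reversal_term q (q ^- M) k.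
Proof.
move=> q0; elim: M => [|M IH].
  by rewrite !big_ord1 /reversal_term !qpoch0 !expr0 !(invr1, expr1, mulr1).
have x0 : q ^- M.+1 != 0 by rewrite invr_eq0 expf_neq0.
have xq : q ^- M.+1 * q = q ^- M by rewrite exprSr invfM mulfVK.
have := reversal_telescope M.+1 q0 x0.
rewrite sumrB -mulr_sumr xq -IH mulVf ?expf_neq0 // mul1r => /eqP.
rewrite subr_eq => /eqP e.
rewrite [RHS]big_ord_recr /= e big_ord_recl /= qpoch0.
have -> : \sum_(i < M.+1) qpoch (q ^- M.+1) q (bump 0 i) =
    (1 - q ^- M.+1) * \sum_(k < M.+1) qpoch (q ^- M) q k.
  by rewrite mulr_sumr; apply: eq_bigr => k _; rewrite qpochSl xq.
ring.
Qed.

Lemma qpoch_inv (F : fieldType) (q : F) k : q != 0 ->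
  qpoch (q^-1 ^+ 2) (q^-1 ^+ 2) k =
  (-1) ^+ k * qpoch (q ^+ 2) (q ^+ 2) k / q ^+ (k * k.+1).
Proof.
move=> q0; elim: k => [|k IH]; first by rewrite !qpoch0 !expr0 !(invr1, mulr1).
rewrite !qpochS IH.
have -> : (k.+1 * k.+2 = k * k.+1 + k + k + 2)%N by lia.
have -> : (q^-1 ^+ 2) ^+ k = (q ^+ k)^-1 ^+ 2 by rewrite -exprM mulnC exprM exprVn.
have -> : (q ^+ 2) ^+ k = (q ^+ k) ^+ 2 by rewrite -exprM mulnC exprM.
rewrite !exprD !exprS expr0.
have := expf_neq0 (k * k.+1) q0; have := expf_neq0 k q0.
move: (q ^+ (k * k.+1)) (q ^+ k) => a b *.
by field; apply/and3P.
Qed.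

(** Both sums stop at k = h, where 1 + z^(h+1) = 0 enters the products; up to
    there, z^-h = -z allows [sum_qpoch_reversal] to be applied. *)
Lemma sum_qpochN_inv (F : fieldType) N h (z : F) : N.+1 = (h.+1 * 2)%N ->
  z ^+ h.+1 = -1 ->
  \sum_(k < N.+1) qpoch (- z) z k =
  - \sum_(k < N.+1) qpoch (z^-1 ^+ 2) (z^-1 ^+ 2) k * z^-1 ^+ k.+1.
Proof.
move=> eN zh.
have z0 : z != 0.
  by apply/eqP => z0; move/eqP: zh; rewrite z0 expr0n eq_sym oppr_eq0 oner_eq0.
have vanish m : qpoch (- z) z (h.+1 + m) = 0.
  by rewrite qpochD qpochS mulNr opprK -exprS zh subrr mulr0 mul0r.
have zV : z ^- h = - z.
  apply: (mulfI (expf_neq0 h z0)).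
  by rewrite divff ?expf_neq0 // mulrN -exprSr zh opprK.
have -> : N.+1 = (h.+1 + h.+1)%N by lia.
rewrite !big_split_ord /= [X in _ + X]big1 => [|k _]; last exact: vanish.
rewrite addr0 [X in - (_ + X)]big1 => [|k _]; last first.
  by rewrite qpoch_inv // qpoch_sqr vanish !(mulr0, mul0r).
rewrite addr0 -zV sum_qpoch_reversal // -sumrN; apply: eq_bigr => k _.
rewrite /reversal_term qpoch_inv // qpoch_sqr zV.
rewrite [(- z) ^+ _]exprNn exprVn.
have := expf_neq0 (k * k.+1) z0; have := expf_neq0 k.+1 z0.
rewrite [(-1) ^+ _.+1]exprS.
have : (-1) ^+ k != 0 :> F by rewrite signr_eq0.
move: (z ^+ (k * k.+1)) (z ^+ k.+1) => a b s0 b0 a0.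
have : (-1) ^+ k * (-1) ^+ k = 1 :> F by rewrite -expr2 sqrr_sign.
move: ((-1) ^+ k) s0 => s s0 s2.
have sV : s^-1 = s by apply: (mulfI s0); rewrite divff.
by rewrite -[in RHS]sV mulN1r; field; rewrite ?s0 ?a0 ?b0 ?oppr_eq0 ?oner_eq0.
Qed.

Theorem proposition3p2 (R : realType) (n : nat) (q : complex R)
    (hn : (1 <= n)%N) (hq : n.-primitive_root q) :
  ((odd n ->
    \sum_(0 <= k < n) qpoch (q ^+ 2) (q ^+ 2) k * q ^+ (k + 1) =
      (-1) / (n%:R ^+ 2) *
      sumz (- n%:Z) (n%:Z - 1) (fun k => sumz (- k) k (fun j =>
        (sgnz k)%:~R * (k ^+ 2 - pentz j)%:~R * (-1) ^ (k + j) *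
        q ^ (k ^+ 2 - pentz j))))
   /\
   (~~ odd n ->
    \sum_(0 <= k < n) qpoch (q ^+ 2) (q ^+ 2) k * q ^+ (k + 1) =
      (-1) / 4%:R *
      sumz (- n%:Z) (n%:Z - 1) (fun k => sumz (- k) k (fun j =>
        (sgnz k)%:~R * (-1) ^ (k + j) * q ^ (k ^+ 2 - pentz j)))))
  /\
  (~~ odd n ->
    \sum_(0 <= k < n) qpoch (- q) q k =
      1 / 4%:R *
      sumz (- n%:Z) (n%:Z - 1) (fun k => sumz (- k) k (fun j =>
        (sgnz k)%:~R * (-1) ^ (k + j) * q ^ (- k ^+ 2 + pentz j)))).
Proof.
case: n hn hq => // N _ hq.
have lhsE : \sum_(0 <= k < N.+1) qpoch (q ^+ 2) (q ^+ 2) k * q ^+ (k + 1) =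
    \sum_(k < N.+1) qpoch (q ^+ 2) (q ^+ 2) k * q ^+ k.+1.
  by rewrite big_mkord; apply: eq_bigr => k _; rewrite addn1.
have half : ~~ odd N.+1 -> exists h, N.+1 = (h.+1 * 2)%N.
  by move=> nodd; exists (N./2); lia.
split; first split; rewrite ?lhsE.
- move=> nodd; rewrite (sum_at_odd_root hq nodd) -sumz_theta; congr (_ * _).
  apply: eq_sumz => k; apply: eq_sumz => j.
  by rewrite mulrA -[in RHS]mulrA [X in X * _ = _]mulrAC mulrA.
- by move=> /half [h eN]; rewrite (sum_at_even_root eN hq) -sumz_theta.
move=> /half [h eN]; rewrite big_mkord.
have qV : N.+1.-primitive_root q^-1.
  have -> : q^-1 = q ^+ N.
    by rewrite -[q ^+ N](mulfK (prim_neq0 hq)) -exprSr (prim_expr_order hq) mul1r.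
  by rewrite (prim_root_exp_coprime _ hq) coprimenS.
have zh : q ^+ h.+1 = -1 by apply: prim_half; rewrite -eN.
rewrite (sum_qpochN_inv eN zh) (sum_at_even_root eN qV) -sumz_theta -mulNr -[- (_ / _)]mulNr opprK.
congr (_ * _).
apply: eq_sumz => k; apply: eq_sumz => j.
by rewrite exprz_inv opprB [pentz j - _]addrC.
Qed.
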